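(* Let $\mathbb{k}$ be a commutative ring and let $\mathcal{G}$ be a finite groupoid. Then there exists a surjective ring homomorphism from the crossed Burnside ring $B^c_{\mathbb{k}}(\mathcal{G})$ to the center $Z(Y_{\mathbb{k}}(\mathcal{G}))$ of the Yoshida algebra of $\mathcal{G}$.
   Context: A groupoid is a (small) category in which every morphism is invertible; $\mathcal{G}_0$, $\mathcal{G}_1$ denote its sets of objects and of morphisms, both finite here. For $x\in\mathcal{G}_0$, $\mathcal{G}_x:=\mathcal{G}(x,x)$ is the isotropy group at $x$. $Z(A)$ denotes the center of a ring $A$. $\mathcal{G}$-sets and representations: $\mathbf{set}$ is the category of finite sets. A $\mathcal{G}$-set is a functor $\mathcal{G}\to\mathbf{set}$; products and disjoint unions of $\mathcal{G}$-sets are objectwise. $\mathbb{k}\text{-}\mathbf{mod}$ is the category of finitely generated $\mathbb{k}$-modules and $\mathbb{k}\text{-}\mathbf{mod}^{\mathcal{G}}$ is the category of functors $\mathcal{G}\to\mathbb{k}\text{-}\mathbf{mod}$ and natural transformations. For a $\mathcal{G}$-set $X$, $\mathbb{k}[X]:\mathcal{G}\to\mathbb{k}\text{-}\mathbf{mod}$ sends $x$ to the free module $\mathbb{k}[X(x)]$ on $X(x)$ and a morphism $g$ to the $\mathbb{k}$-linear extension of $X(g)$. The endomorphism set $\mathbb{k}\text{-}\mathbf{mod}^{\mathcal{G}}(\mathbb{k}[X],\mathbb{k}[X])$ is a ring under objectwise addition and composition. Crossed Burnside ring: Let $\mathcal{G}^c$ be the functor from $\mathcal{G}$ to monoids with $\mathcal{G}^c(x)=\mathcal{G}_x$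 and, for $g:x\to y$, $\mathcal{G}^c(g)(a)=gag^{-1}$; it is also regarded as a $\mathcal{G}$-set. The slice category $\mathbf{set}^{\mathcal{G}}/\mathcal{G}^c$ has as objects the natural transformations $Y\to\mathcal{G}^c$ from $\mathcal{G}$-sets $Y$. It has the monoidal product $(Y\xrightarrow{\theta}\mathcal{G}^c)\otimes(Z\xrightarrow{\tau}\mathcal{G}^c):=(Y\times Z\xrightarrow{\theta\times\tau}\mathcal{G}^c\times\mathcal{G}^c\xrightarrow{m}\mathcal{G}^c)$, with $m$ the objectwise multiplication (the unit object is the one-point $\mathcal{G}$-set mapping to identity elements). $B^c(\mathcal{G},\mathcal{G}^c)$ is the Grothendieck group of the commutative monoid of isomorphism classes of $\mathbf{set}^{\mathcal{G}}/\mathcal{G}^c$ under disjoint union, with multiplication induced by $\otimes$, and $B^c_{\mathbb{k}}(\mathcal{G}):=\mathbb{k}\otimes_{\mathbb{Z}}B^c(\mathcal{G},\mathcal{G}^c)$. The $\mathcal{G}$-set $\Omega$: Let $\mathcal{G}\cong\coprod_{i=1}^n\mathcal{G}[i]$ be the decomposition into connected components. For a finite set $X$, $\mathrm{Pair}(X)$ is the groupoid with object set $X$ and exactly one morphism $(x,y):x\to y$ for each $(x,y)\in X\times X$. For each $i$ fix a base object $x_i\in\mathcal{G}[i]_0$ and an identification (identity on objects) $\mathcal{G}[i]\cong\mathcal{G}_{x_i}\times\mathrm{Pair}(\mathcal{G}[i]_0)$, and write $\lambda_{x,y}\in\mathcal{G}(x,y)$ for the morphism corresponding to $(x,y)$ (with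 identity group component); thus $\lambda_{x,x}=\mathrm{id}_x$ and $\lambda_{y,z}\lambda_{x,y}=\lambda_{x,z}$. The functor $\Omega:\mathcal{G}\to\mathbf{set}$ is given by $\Omega(x):=\coprod_{H\le\mathcal{G}_x}\mathcal{G}_x/H$ (disjoint union over all subgroups $H$, elements written $\langle H,kH\rangle$), and for $g:x\to y$, $\Omega(g)\langle H,kH\rangle:=\langle\lambda_{x,y}H\lambda_{x,y}^{-1},\,gkH\lambda_{x,y}^{-1}\rangle$. Yoshida algebra: $Y_{\mathbb{k}}(\mathcal{G}):=\mathbb{k}\text{-}\mathbf{mod}^{\mathcal{G}}(\mathbb{k}[\Omega^2],\mathbb{k}[\Omega^2])$, where $\Omega^2=\Omega\times\Omega$. *)

(* Defs.v *)
From HB Require Import structures.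
From mathcomp Require Import all_boot all_order all_algebra all_fingroup.
From mathcomp Require Import boolp.

Set Implicit Arguments.
Unset Strict Implicit.
Unset Printing Implicit Defensive.

Import GRing.Theory.
Local Open Scope ring_scope.
Local Open Scope quotient_scope.

(* [repr] alone is the coset representative of fingroup *)
Notation qrepr := generic_quotient.repr.

Section PropQuotient.

Variables (T : choiceType) (E : T -> T -> Prop).
Hypothesis (Er : forall x, E x x) (Es : forall x y, E x y -> E y x).
Hypothesis Et : forall x y z, E x y -> E y z -> E x z.

Definition prop_equiv : equiv_rel T.
Proof.
apply: (@EquivRelPack T (fun x y => `[< E x y >])); split.
- by move=> x; apply/asboolP.
- by move=> x y; apply/asboolP/asboolP; apply: Es.
- by move=> y x z /asboolP xy /asboolP yz; apply/asboolP; apply: Et yz.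
Defined.

Lemma prop_quotP x y : (\pi_{eq_quot prop_equiv} x = \pi y) <-> E x y.
Proof.
by split=> [/eqquotP/asboolP|xy]; last by apply/eqquotP/asboolP.
Qed.

Lemma prop_quot_repr x : E (qrepr (\pi_{eq_quot prop_equiv} x)) x.
Proof. by apply/prop_quotP; rewrite reprK. Qed.

End PropQuotient.

Section Center.

Variable R : pzRingType.

Definition central : {pred R} := [pred z : R | `[< forall y, z * y = y * z >]].

Lemma centralP z : reflect (forall y, z * y = y * z) (z \in central).
Proof. exact: asboolP. Qed.

Lemma central_subring : subring_closed central.
Proof.
split=> [|z w /centralP cz /centralP cw|z w /centralP cz /centralP cw].
- by apply/centralP=> y; rewrite mul1r mulr1.
- by apply/centralP=> y; rewrite mulrBl mulrBr cz cw.
- by apply/centralP=> y; rewrite -mulrA cw mulrA cz mulrA.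
Qed.

Record center := Center { center_val :> R; _ : center_val \in central }.

HB.instance Definition _ := [isSub for center_val].
HB.instance Definition _ := [Choice of center by <:].
HB.instance Definition _ :=
  GRing.SubChoice_isSubPzRing.Build R central center central_subring.

End Center.

Section GrothendieckGroup.

Variable M : nmodType.

Definition groth_eq (p q : M * M) : Prop :=
  exists c, p.1 + q.2 + c = q.1 + p.2 + c.

Lemma groth_eq_refl p : groth_eq p p. Proof. by exists 0. Qed.

Lemma groth_eq_sym p q : groth_eq p q -> groth_eq q p.
Proof. by case=> c e; exists c. Qed.

Lemma groth_eq_trans p q r : groth_eq p q -> groth_eq q r -> groth_eq p r.
Proof.
case: p q r => [p1 p2] [q1 q2] [r1 r2] [c /= e] [d /= f].
exists (q2 + c + d + q1).
transitivity ((p1 + q2 + c) + (r2 + d + q1)); first by rewrite !addrA (ACl (1*3*4*2*5*6)%AC).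
rewrite e.
transitivity ((q1 + r2 + d) + (p2 + c + q1)); first by rewrite !addrA (ACl (1*4*5*2*3*6)%AC).
by rewrite f !addrA (ACl (1*4*2*5*3*6)%AC).
Qed.

Definition groth := {eq_quot prop_equiv groth_eq_refl groth_eq_sym groth_eq_trans}.
HB.instance Definition _ := Choice.on groth.

Definition groth_pi (p : M * M) : groth := \pi p.

Lemma groth_piP p q : groth_pi p = groth_pi q <-> groth_eq p q.
Proof. exact: prop_quotP. Qed.

Lemma groth_repr p : groth_eq (qrepr (groth_pi p)) p.
Proof. exact: prop_quot_repr. Qed.

Lemma grothW (P : groth -> Prop) : (forall p, P (groth_pi p)) -> forall x, P x.
Proof. by move=> h; elim/quotW. Qed.

Definition groth_zero : groth := groth_pi (0, 0).
Definition groth_opp (x : groth) : groth :=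
  groth_pi ((qrepr x).2, (qrepr x).1).
Definition groth_add (x y : groth) : groth :=
  groth_pi ((qrepr x).1 + (qrepr y).1, (qrepr x).2 + (qrepr y).2).

Lemma groth_oppE p : groth_opp (groth_pi p) = groth_pi (p.2, p.1).
Proof.
apply/groth_piP; have [c] := groth_repr p; case: (qrepr _) => a b /= e.
by exists c; rewrite /= [b + _]addrC -e [p.2 + _]addrC.
Qed.

Lemma groth_addE p q :
  groth_add (groth_pi p) (groth_pi q) = groth_pi (p.1 + q.1, p.2 + q.2).
Proof.
apply/groth_piP; have [c] := groth_repr p; have [d] := groth_repr q.
case: (qrepr _) => a b; case: (qrepr _) => a' b' /= f e; exists (c + d) => /=.
transitivity ((a' + p.2 + c) + (a + q.2 + d)); first by rewrite !addrA (ACl (1*3*5*2*4*6)%AC).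
by rewrite e f !addrA (ACl (1*4*2*5*3*6)%AC).
Qed.

Lemma groth_addA : associative groth_add.
Proof.
elim/grothW=> p; elim/grothW=> q; elim/grothW=> r.
by rewrite !groth_addE /= !addrA.
Qed.

Lemma groth_addC : commutative groth_add.
Proof.
elim/grothW=> p; elim/grothW=> q.
by rewrite !groth_addE addrC [p.2 + _]addrC.
Qed.

Lemma groth_add0 : left_id groth_zero groth_add.
Proof. by elim/grothW=> p; rewrite groth_addE /= !add0r; case: p. Qed.

Lemma groth_addN : left_inverse groth_zero groth_opp groth_add.
Proof.
elim/grothW=> p; rewrite groth_oppE groth_addE /=; apply/groth_piP.
by exists 0; rewrite /= !addr0 add0r addrC.
Qed.

HB.instance Definition _ :=
  GRing.isZmodule.Build groth groth_addA groth_addC groth_add0 groth_addN.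

End GrothendieckGroup.

Section GrothendieckRing.

Variable R : pzSemiRingType.
Local Notation pi := (@groth_pi R).

Definition groth_one : groth R := pi (1, 0).
Definition groth_mul (x y : groth R) : groth R :=
  let: (a, b) := qrepr x in let: (c, d) := qrepr y in
  pi (a * c + b * d, a * d + b * c).

Lemma groth_mulE p q :
  groth_mul (pi p) (pi q) =
  pi (p.1 * q.1 + p.2 * q.2, p.1 * q.2 + p.2 * q.1).
Proof.
rewrite /groth_mul; have [c] := groth_repr p; have [d] := groth_repr q.
case: (qrepr _) => a b; case: (qrepr _) => a' b' /= f e; case: p q e f => [p1 p2] [q1 q2] /= e f.
transitivity (pi (p1 * a + p2 * b, p1 * b + p2 * a)); apply/groth_piP.
  exists (c * a + c * b) => /=.
  transitivity ((a' + p2 + c) * a + (p1 + b' + c) * b).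
    by rewrite !mulrDl !addrA (ACl (1*4*5*3*2*6)%AC).
  rewrite {1}e -[in X in _ + X]e.
  by rewrite !mulrDl !addrA (ACl (1*5*4*2*3*6)%AC).
exists (p1 * d + p2 * d) => /=.
transitivity (p1 * (a + q2 + d) + p2 * (q1 + b + d)).
  by rewrite !mulrDr !addrA (ACl (1*3*5*4*2*6)%AC).
rewrite {1}f -[in X in _ + X]f.
by rewrite !mulrDr !addrA (ACl (1*5*2*4*3*6)%AC).
Qed.

Lemma groth_mulA : associative groth_mul.
Proof.
elim/grothW=> -[a b]; elim/grothW=> -[c d]; elim/grothW=> -[e f].
rewrite !groth_mulE /=; congr pi; congr pair; rewrite !mulrDl !mulrDr !mulrA !addrA.
  by rewrite (ACl (1*4*2*3)%AC).
by rewrite (ACl (1*4*2*3)%AC).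
Qed.

Lemma groth_mul1l : left_id groth_one groth_mul.
Proof.
by elim/grothW=> -[a b]; rewrite groth_mulE /= !mul1r !mul0r !addr0.
Qed.

Lemma groth_mul1r : right_id groth_one groth_mul.
Proof.
by elim/grothW=> -[a b]; rewrite groth_mulE /= !mulr1 !mulr0 !addr0 add0r.
Qed.

Lemma groth_mulDl : left_distributive groth_mul +%R.
Proof.
elim/grothW=> -[a b]; elim/grothW=> -[c d]; elim/grothW=> -[e f].
rewrite [X in groth_mul X _]groth_addE !groth_mulE.
rewrite [RHS]groth_addE /=; congr pi.
by rewrite !mulrDl !addrA; congr pair; rewrite [LHS](ACl (1*3*2*4)%AC).
Qed.

Lemma groth_mulDr : right_distributive groth_mul +%R.
Proof.
elim/grothW=> -[a b]; elim/grothW=> -[c d]; elim/grothW=> -[e f].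
rewrite [X in groth_mul _ X]groth_addE !groth_mulE.
rewrite [RHS]groth_addE /=; congr pi.
by rewrite !mulrDr !addrA; congr pair; rewrite [LHS](ACl (1*3*2*4)%AC).
Qed.

HB.instance Definition _ := GRing.Zmodule_isPzRing.Build (groth R)
  groth_mulA groth_mul1l groth_mul1r groth_mulDl groth_mulDr.

End GrothendieckRing.

Section Tensor.

Variables U V : zmodType.

(* A list [:: (u1, v1); ...] stands for the sum of the u_i (x) v_i. Negatives
   are not needed as formal symbols: (- u, v) is the opposite of (u, v). *)
Inductive tensor_eq : seq (U * V) -> seq (U * V) -> Prop :=
| TensorRefl s : tensor_eq s s
| TensorSym s t : tensor_eq s t -> tensor_eq t s
| TensorTrans s t r : tensor_eq s t -> tensor_eq t r -> tensor_eq s r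
| TensorCat s s' t t' :
    tensor_eq s s' -> tensor_eq t t' -> tensor_eq (s ++ t) (s' ++ t')
| TensorComm s t : tensor_eq (s ++ t) (t ++ s)
| TensorDl u u' v : tensor_eq [:: (u + u', v)] [:: (u, v); (u', v)]
| TensorDr u v v' : tensor_eq [:: (u, v + v')] [:: (u, v); (u, v')]
| Tensor0l v : tensor_eq [:: (0, v)] [::]
| Tensor0r u : tensor_eq [:: (u, 0)] [::].

Definition tensor :=
  {eq_quot prop_equiv TensorRefl TensorSym TensorTrans}.
HB.instance Definition _ := Choice.on tensor.

Definition tensor_pi (s : seq (U * V)) : tensor := \pi s.

Lemma tensor_piP s t : tensor_pi s = tensor_pi t <-> tensor_eq s t.
Proof. exact: prop_quotP. Qed.

Lemma tensor_repr s : tensor_eq (qrepr (tensor_pi s)) s.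
Proof. exact: prop_quot_repr. Qed.

Lemma tensorW (P : tensor -> Prop) :
  (forall s, P (tensor_pi s)) -> forall x, P x.
Proof. by move=> h; elim/quotW. Qed.

Lemma perm_tensor_eq s t : perm_eq s t -> tensor_eq s t.
Proof.
elim: s t => [|p s IHs] t.
  by rewrite perm_sym => /perm_nilP->; apply: TensorRefl.
move=> pst; have /splitPr tp : p \in t by rewrite -(perm_mem pst) mem_head.
case: tp pst => t1 t2; rewrite perm_sym perm_catC /= perm_cons perm_catC perm_sym.
move=> /IHs h.
apply: (@TensorTrans _ ([:: p] ++ (t2 ++ t1))).
  rewrite -cat1s; apply: TensorCat (TensorRefl _) _.
  exact: TensorTrans h (TensorComm _ _).
by rewrite catA; apply: TensorComm.
Qed.

Definition tensor_zero : tensor := tensor_pi [::].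
Definition tensor_add (x y : tensor) : tensor :=
  tensor_pi (qrepr x ++ qrepr y).
Definition tensor_opp (x : tensor) : tensor :=
  tensor_pi [seq (- p.1, p.2) | p <- qrepr x].

Lemma tensor_addE s t :
  tensor_add (tensor_pi s) (tensor_pi t) = tensor_pi (s ++ t).
Proof. by apply/tensor_piP/TensorCat; apply: tensor_repr. Qed.

Lemma tensor_addA : associative tensor_add.
Proof.
elim/tensorW=> s; elim/tensorW=> t; elim/tensorW=> r.
by rewrite !tensor_addE catA.
Qed.

Lemma tensor_addC : commutative tensor_add.
Proof.
elim/tensorW=> s; elim/tensorW=> t; rewrite !tensor_addE.
by apply/tensor_piP; apply: TensorComm.
Qed.

Lemma tensor_add0 : left_id tensor_zero tensor_add.
Proof. by elim/tensorW=> s; rewrite tensor_addE. Qed.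

Lemma tensor_addN : left_inverse tensor_zero tensor_opp tensor_add.
Proof.
elim/quotW=> s; rewrite /tensor_opp -[X in tensor_add _ X]reprK.
move: (qrepr _) => {}s; rewrite [LHS]tensor_addE; apply/tensor_piP.
elim: s => [|[u v] s IHs] /=; first exact: TensorRefl.
apply: (@TensorTrans _ ([:: (- u, v); (u, v)] ++
    ([seq (- p.1, p.2) | p <- s] ++ s))).
  apply: perm_tensor_eq; rewrite /= perm_cons.
  by rewrite -cat1s perm_catCA /= perm_refl.
rewrite -[X in tensor_eq _ X]cats0; apply: TensorCat IHs.
apply: TensorTrans (Tensor0l v); apply: TensorSym.
by have := TensorDl (- u) u v; rewrite addNr.
Qed.

HB.instance Definition _ := GRing.isZmodule.Build tensor
  tensor_addA tensor_addC tensor_add0 tensor_addN.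

End Tensor.

Section TensorRing.

Variables A B : pzRingType.
Local Notation pi := (@tensor_pi A B).
Local Notation teq := (@tensor_eq A B).

Definition pair_mul (p q : A * B) : A * B := (p.1 * q.1, p.2 * q.2).
Definition tensor_seq_mul (s t : seq (A * B)) : seq (A * B) :=
  [seq pair_mul p q | p <- s, q <- t].

Definition tensor_one : tensor A B := pi [:: (1, 1)].
Definition tensor_mul (x y : tensor A B) : tensor A B :=
  pi (tensor_seq_mul (qrepr x) (qrepr y)).

Lemma map_mull_eq p s t : teq s t ->
  teq [seq pair_mul p q | q <- s] [seq pair_mul p q | q <- t].
Proof.
elim=> {s t} [s|s t _|s t r _ h1 _|s s' t t' _ h1 _ h2|s t|u u' v|u v v'|v|u];
  rewrite ?map_cat /= /pair_mul /= ?mulrDr ?mulr0.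
- exact: TensorRefl.
- exact: TensorSym.
- exact: TensorTrans.
- exact: TensorCat.
- exact: TensorComm.
- exact: TensorDl.
- exact: TensorDr.
- exact: Tensor0l.
- exact: Tensor0r.
Qed.

Lemma map_mulr_eq p s t : teq s t ->
  teq [seq pair_mul q p | q <- s] [seq pair_mul q p | q <- t].
Proof.
elim=> {s t} [s|s t _|s t r _ h1 _|s s' t t' _ h1 _ h2|s t|u u' v|u v v'|v|u];
  rewrite ?map_cat /= /pair_mul /= ?mulrDl ?mul0r.
- exact: TensorRefl.
- exact: TensorSym.
- exact: TensorTrans.
- exact: TensorCat.
- exact: TensorComm.
- exact: TensorDl.
- exact: TensorDr.
- exact: Tensor0l.
- exact: Tensor0r.
Qed.

Lemma tensor_seq_mul_eqr s t t' :
  teq t t' -> teq (tensor_seq_mul s t) (tensor_seq_mul s t').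
Proof.
move=> tt'; elim: s => [|p s IHs]; first exact: TensorRefl.
by rewrite /tensor_seq_mul !allpairs_cons; apply: TensorCat IHs; apply: map_mull_eq.
Qed.

Lemma tensor_seq_mul_eql s s' t :
  teq s s' -> teq (tensor_seq_mul s t) (tensor_seq_mul s' t).
Proof.
move=> ss'; elim: t => [|q t IHt].
  by rewrite /tensor_seq_mul !allpairs0r; apply: TensorRefl.
have consE r : teq (tensor_seq_mul r (q :: t))
    ([seq pair_mul p q | p <- r] ++ tensor_seq_mul r t).
  by apply: perm_tensor_eq; rewrite /tensor_seq_mul perm_allpairs_consr.
apply: TensorTrans (consE s) _; apply: TensorTrans (TensorSym (consE s')).
by apply: TensorCat IHt; apply: map_mulr_eq.
Qed.

Lemma tensor_mulE s t : tensor_mul (pi s) (pi t) = pi (tensor_seq_mul s t).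
Proof.
apply/tensor_piP; apply: TensorTrans (tensor_seq_mul_eql _ (tensor_repr _)) _.
exact/tensor_seq_mul_eqr/tensor_repr.
Qed.

Lemma tensor_seq_mulDl s s' t :
  tensor_seq_mul (s ++ s') t = tensor_seq_mul s t ++ tensor_seq_mul s' t.
Proof. exact: allpairs_cat. Qed.

Lemma tensor_mulA : associative tensor_mul.
Proof.
elim/tensorW=> s; elim/tensorW=> t; elim/tensorW=> r; rewrite !tensor_mulE.
congr pi; elim: s => [//|p s IHs].
rewrite /tensor_seq_mul !allpairs_cons -/(tensor_seq_mul _ _).
rewrite -[RHS]/(tensor_seq_mul _ r) tensor_seq_mulDl; congr (_ ++ _); last exact: IHs.
rewrite /tensor_seq_mul map_allpairs allpairs_mapl.
by apply: eq_allpairs => a b; rewrite /pair_mul /= !mulrA.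
Qed.

Lemma tensor_mul1l : left_id tensor_one tensor_mul.
Proof.
elim/tensorW=> s; rewrite tensor_mulE; congr pi.
rewrite /tensor_seq_mul /= cats0 -[RHS]map_id; apply: eq_map => -[a b].
by rewrite /pair_mul /= !mul1r.
Qed.

Lemma tensor_mul1r : right_id tensor_one tensor_mul.
Proof.
elim/tensorW=> s; rewrite tensor_mulE; congr pi.
rewrite /tensor_seq_mul allpairs1r -[RHS]map_id; apply: eq_map => -[a b].
by rewrite /pair_mul /= !mulr1.
Qed.

Lemma tensor_mulDl : left_distributive tensor_mul +%R.
Proof.
elim/tensorW=> s; elim/tensorW=> t; elim/tensorW=> r.
rewrite [X in tensor_mul X _]tensor_addE !tensor_mulE [RHS]tensor_addE.
by rewrite tensor_seq_mulDl.
Qed.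

Lemma tensor_mulDr : right_distributive tensor_mul +%R.
Proof.
elim/tensorW=> s; elim/tensorW=> t; elim/tensorW=> r.
rewrite [X in tensor_mul _ X]tensor_addE !tensor_mulE [RHS]tensor_addE.
by apply/tensor_piP/perm_tensor_eq; rewrite /tensor_seq_mul perm_allpairs_catr.
Qed.

HB.instance Definition _ := GRing.Zmodule_isPzRing.Build (tensor A B)
  tensor_mulA tensor_mul1l tensor_mul1r tensor_mulDl tensor_mulDr.

End TensorRing.

Declare Scope groupoid_scope.
Delimit Scope groupoid_scope with gpd.
Local Open Scope groupoid_scope.

Record groupoid := Groupoid {
  obj :> finType;
  hom : obj -> obj -> finType;
  gid : forall x, hom x x;
  gcomp : forall x y z, hom y z -> hom x y -> hom x z;
  ginv : forall x y, hom x y -> hom y x;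
  gcompA : forall x y z w (h : hom z w) (g : hom y z) (f : hom x y),
    gcomp h (gcomp g f) = gcomp (gcomp h g) f;
  gcomp1g : forall x y (f : hom x y), gcomp (gid y) f = f;
  gcompg1 : forall x y (f : hom x y), gcomp f (gid x) = f;
  gcompVg : forall x y (f : hom x y), gcomp (ginv f) f = gid x;
  gcompgV : forall x y (f : hom x y), gcomp f (ginv f) = gid y;
}.

Arguments gid {G} x : rename.
Arguments gcomp {G x y z} : rename.
Arguments ginv {G x y} : rename.

Notation "g ** f" := (gcomp g f) (at level 40, left associativity)
  : groupoid_scope.
Notation "f ^-1" := (ginv f) : groupoid_scope.

Section GroupoidTheory.

Variable G : groupoid.
Implicit Types x y z : G.

Lemma gcompKV x y z (f : hom y x) (g : hom y z) : g ** f^-1 ** f = g.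
Proof. by rewrite -gcompA gcompVg gcompg1. Qed.

Lemma gcompVK x y z (f : hom x y) (g : hom y z) : g ** f ** f^-1 = g.
Proof. by rewrite -gcompA gcompgV gcompg1. Qed.

Lemma ginv_unique x y (f : hom x y) (g : hom y x) : g ** f = gid x -> g = f^-1.
Proof. by move=> e; rewrite -[f^-1]gcomp1g -e gcompVK. Qed.

Lemma ginv1 x : (gid x)^-1 = gid x.
Proof. by apply/esym/ginv_unique; rewrite gcomp1g. Qed.

Lemma ginvM x y z (g : hom y z) (f : hom x y) : (g ** f)^-1 = f^-1 ** g^-1.
Proof. by apply/esym/ginv_unique; rewrite !gcompA gcompKV gcompVg. Qed.

Definition isotropy x : Type := hom x x.
HB.instance Definition _ x := Finite.on (isotropy x).
HB.instance Definition _ x := Finite_isGroup.Build (isotropy x)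
  (@gcompA G x x x x) (@gcomp1g G x x) (@gcompVg G x x).

Definition conj_hom x y (g : hom x y) (a : isotropy x) : isotropy y :=
  g ** a ** g^-1.

Lemma conj_homM x y (g : hom x y) :
  {in [set: isotropy x] &, {morph conj_hom g : a b / (a * b)%g}}.
Proof.
move=> a b _ _; rewrite /conj_hom -[(a * b)%g]/(a ** b).
by rewrite -[RHS]/(_ ** _) !gcompA gcompKV.
Qed.

Canonical conj_morphism x y (g : hom x y) := Morphism (conj_homM g).

Lemma conj_hom1 x (a : isotropy x) : conj_hom (gid x) a = a.
Proof. by rewrite /conj_hom ginv1 gcomp1g gcompg1. Qed.

Lemma conj_hom_comp x y z (h : hom y z) (g : hom x y) a :
  conj_hom (h ** g) a = conj_hom h (conj_hom g a).
Proof. by rewrite /conj_hom ginvM !gcompA. Qed.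

Definition connected x y : bool := [exists g : hom x y, true].

Lemma connected_hom x y : hom x y -> connected x y.
Proof. by move=> g; apply/existsP; exists g. Qed.

Lemma connectedP x y : connected x y -> exists g : hom x y, true.
Proof. by move/existsP. Qed.

Lemma connected_refl x : connected x x.
Proof. exact: connected_hom (gid x). Qed.

Lemma connected_equiv : {in [set: G] & &, equivalence_rel connected}.
Proof.
move=> x y z _ _ _; split; first exact: connected_refl.
move=> /connectedP[f _]; apply/idP/idP => /connectedP[g _].
  exact: connected_hom (g ** f^-1).
exact: connected_hom (g ** f).
Qed.

Record component := Component {
  component_set : {set G};
  component_mem :
    component_set \in equivalence_partition connected [set: G];
}.

Lemma component_inj : injective component_set.
Proof.
by move=> [C c] [D d] /= e; case: _ / e d => d; rewrite (bool_irrelevance c d).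
Qed.

Section FullSubgroupoid.

Variable C : {set G}.

Local Notation ob := {x : G | x \in C}.

Definition full_subgroupoid : groupoid.
Proof.
refine (@Groupoid ob (fun x y : ob => hom (val x) (val y))
  (fun x : ob => gid (val x))
  (fun x y z : ob => @gcomp G (val x) (val y) (val z))
  (fun x y : ob => @ginv G (val x) (val y)) _ _ _ _ _).
- by move=> *; apply: gcompA.
- by move=> *; apply: gcomp1g.
- by move=> *; apply: gcompg1.
- by move=> *; apply: gcompVg.
- by move=> *; apply: gcompgV.
Defined.

End FullSubgroupoid.

Definition component_groupoid (i : component) : groupoid :=
  full_subgroupoid (component_set i).

End GroupoidTheory.

Coercion component_groupoid : component >-> groupoid.

Definition group_groupoid (gT : finGroupType) : groupoid.
Proof.
refine (@Groupoid unit (fun _ _ => gT) (fun _ => 1%g) (fun _ _ _ g f => (g * f)%g)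
  (fun _ _ g => g^-1%g) _ _ _ _ _).
- by move=> *; apply: mulgA.
- by move=> *; apply: mul1g.
- by move=> *; apply: mulg1.
- by move=> *; apply: mulVg.
- by move=> *; apply: mulgV.
Defined.

Definition pair_groupoid (X : finType) : groupoid.
Proof.
refine (@Groupoid X (fun _ _ => unit) (fun _ => tt) (fun _ _ _ _ _ => tt)
  (fun _ _ _ => tt) _ _ _ _ _) => //; by move=> ? ? [].
Defined.

Definition prod_groupoid (A B : groupoid) : groupoid.
Proof.
refine (@Groupoid (A * B)%type (fun x y => (hom x.1 y.1 * hom x.2 y.2)%type)
  (fun x => (gid x.1, gid x.2)) (fun _ _ _ g f => (g.1 ** f.1, g.2 ** f.2))
  (fun _ _ g => (g.1^-1, g.2^-1)) _ _ _ _ _).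
- by move=> *; rewrite !gcompA.
- by move=> ? ? [? ?] /=; rewrite !gcomp1g.
- by move=> ? ? [? ?] /=; rewrite !gcompg1.
- by move=> ? ? [? ?] /=; rewrite !gcompVg.
- by move=> ? ? [? ?] /=; rewrite !gcompgV.
Defined.

(* A functor with prescribed object part [F0], bijective on each hom-set; it is
   an isomorphism of groupoids when [F0] is a bijection. *)
Record iso_over (A B : groupoid) (F0 : A -> B) := IsoOver {
  iso_fwd : forall x y, hom x y -> hom (F0 x) (F0 y);
  iso_bwd : forall x y, hom (F0 x) (F0 y) -> hom x y;
  iso_fwd1 : forall x, iso_fwd (gid x) = gid (F0 x);
  iso_fwdM : forall x y z (g : hom y z) (f : hom x y),
    iso_fwd (g ** f) = iso_fwd g ** iso_fwd f;
  iso_fwdK : forall x y, cancel (@iso_fwd x y) (@iso_bwd x y);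
  iso_bwdK : forall x y, cancel (@iso_bwd x y) (@iso_fwd x y);
}.

(* Base objects x_i of the components, and the identifications, identity on
   objects, of G[i] with the product of the group at x_i and Pair(G[i]_0). *)
Record trivialization (G : groupoid) := Trivialization {
  base : forall i : component G, i;
  triv : forall i : component G,
    @iso_over i
      (prod_groupoid (group_groupoid (isotropy (val (base i)))) (pair_groupoid i))
      (fun x => (tt, x));
}.

Section Lambda.

Variables (G : groupoid) (t : trivialization G).
Implicit Types x y z : G.

Definition lambda_in (i : component G) (x y : i) : hom x y :=
  @iso_bwd _ _ _ (triv t i) x y (1%g, tt).

Lemma lambda_in1 i (x : (i : component G)) : lambda_in x x = gid x.
Proof.
by rewrite /lambda_in -[RHS](iso_fwdK (triv t i)) iso_fwd1.
Qed.

Lemma lambda_inM i (x y z : (i : component G)) :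
  lambda_in y z ** lambda_in x y = lambda_in x z.
Proof.
rewrite -[LHS](iso_fwdK (triv t i)) iso_fwdM !iso_bwdK.
by congr iso_bwd; rewrite /= mulg1.
Qed.

Lemma component_of_subproof x :
  [set y | connected x y] \in equivalence_partition (@connected G) [set: G].
Proof.
apply/imsetP; exists x; rewrite ?inE //.
by apply/setP=> y; rewrite !inE.
Qed.

Definition component_of x : component G := Component (component_of_subproof x).

Lemma mem_component_of x y : connected x y -> y \in component_set (component_of x).
Proof. by rewrite inE. Qed.

Definition lambda x y (xy : connected x y) : hom x y :=
  @lambda_in (component_of x)
    (exist _ x (mem_component_of (connected_refl x)))
    (exist _ y (mem_component_of xy)).

Lemma lambdaE i x y (xi : x \in component_set (i : component G)) (yi : y \in component_set i)
    (xy : connected x y) :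
  lambda xy = @lambda_in i (exist _ x xi) (exist _ y yi).
Proof.
have ii : i = component_of x.
  case: i xi {yi} => C /= mC xC; apply: component_inj => /=.
  case/imsetP: mC xC => w _ ->.
  rewrite !inE => wx; apply/setP=> u; rewrite !inE.
  have [_ /(_ wx)] := connected_equiv (in_setT w) (in_setT x) (in_setT u).
  by [].
subst i; rewrite /lambda.
rewrite (bool_irrelevance xi (mem_component_of (connected_refl x))).
by rewrite (bool_irrelevance yi (mem_component_of xy)).
Qed.

Lemma lambda1 x (xx : connected x x) : lambda xx = gid x.
Proof.
have h := mem_component_of (connected_refl x).
by rewrite (lambdaE h h) lambda_in1.
Qed.

Lemma lambdaM x y z (yz : connected y z) (xy : connected x y)
  (xz : connected x z) : lambda yz ** lambda xy = lambda xz.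
Proof.
have hx := mem_component_of (connected_refl x).
have hy := mem_component_of xy; have hz := mem_component_of xz.
rewrite (lambdaE hy hz) (lambdaE hx hy) (lambdaE hx hz).
exact: (@lambda_inM (component_of x)
  (exist _ x hx) (exist _ y hy) (exist _ z hz)).
Qed.

End Lambda.

Lemma trivialization_exists (G : groupoid) : inhabited (trivialization G).
Proof.
have base i : {b : G | b \in component_set (i : component G)}.
  apply: cid; case: i => C /= /imsetP[w _ ->]; exists w.
  by rewrite !inE connected_refl.
have gam (i : component G) (x : i) : {g : hom (val (base i)) (val x) | true}.
  apply: cid; case: i (base i) x => C /= mC [b bC] [x xC] /=.
  case/imsetP: mC bC xC => w _ ->; rewrite !inE => wb wx.
  have [_ /(_ wb)] := connected_equiv (in_setT w) (in_setT b) (in_setT x).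
  by rewrite (wx : connected w x) => /esym/connectedP.
split; apply: (@Trivialization G base) => i.
pose c (x : i) : hom (val (base i)) (val x) := sval (gam i x).
pose fwd (x y : i) (g : hom (val x) (val y)) :=
  ((c y)^-1 ** g ** c x : isotropy (val (base i)), tt).
pose bwd (x y : i) (h : isotropy (val (base i)) * unit) :=
  c y ** h.1 ** (c x)^-1.
apply: (@IsoOver i (prod_groupoid (group_groupoid (isotropy (val (base i))))
  (pair_groupoid i)) _ fwd bwd).
- by move=> x; rewrite /fwd gcompg1 gcompVg.
- move=> x y z g f; rewrite /fwd; congr pair.
  have key (g' : hom (val y) (val z)) (f' : hom (val x) (val y)) :
      (c z)^-1 ** (g' ** f') ** c x =
      ((c z)^-1 ** g' ** c y) ** ((c y)^-1 ** f' ** c x).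
    by rewrite !gcompA gcompVK.
  exact: key.
- by move=> x y g; rewrite /fwd /bwd /= !gcompA gcompVK gcompgV gcomp1g.
- move=> x y [h []]; rewrite /fwd /bwd /=.
  by rewrite !gcompA gcompKV gcompVg gcomp1g.
Qed.

Record gset_on (G : groupoid) (X : G -> finType) := GsetOn {
  act : forall x y, hom x y -> X x -> X y;
  act1 : forall x u, act (gid x) u = u;
  actM : forall x y z (g : hom y z) (f : hom x y) u,
    act (g ** f) u = act g (act f u);
}.

Record gset (G : groupoid) := Gset {
  gset_obj :> G -> finType;
  gset_struct :> gset_on gset_obj;
}.

Record gset_hom (G : groupoid) (X Y : gset G) := GsetHom {
  gset_fun :> forall x, X x -> Y x;
  gset_nat : forall x y (g : hom x y) u,
    gset_fun (act X g u) = act Y g (gset_fun u);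
}.

Section GsetOps.

Variable G : groupoid.

Section ProdSum.

Variables X Y : G -> finType.
Variables (aX : gset_on X) (aY : gset_on Y).

Definition prod_gset_on : gset_on (fun x => (X x * Y x)%type : finType).
Proof.
refine (@GsetOn G (fun x => (X x * Y x)%type : finType)
  (fun x y (g : hom x y) u => (act aX g u.1, act aY g u.2)) _ _).
- by move=> x [u v] /=; rewrite !act1.
- by move=> x y z g f [u v] /=; rewrite !actM.
Defined.

Definition sum_gset_on : gset_on (fun x => (X x + Y x)%type : finType).
Proof.
refine (@GsetOn G (fun x => (X x + Y x)%type : finType)
  (fun x y (g : hom x y) w =>
    match w with inl u => inl (act aX g u) | inr v => inr (act aY g v) end) _ _).
- by move=> x [u|v] /=; rewrite act1.
- by move=> x y z g f [u|v] /=; rewrite actM.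
Defined.

End ProdSum.

Definition empty_gset_on : gset_on (fun _ : G => void : finType).
Proof. by refine (@GsetOn G (fun _ => void : finType) (fun _ _ _ u => u) _ _). Defined.

Definition unit_gset_on : gset_on (fun _ : G => unit : finType).
Proof. by refine (@GsetOn G (fun _ => unit : finType) (fun _ _ _ u => u) _ _). Defined.

Definition prod_gset (X Y : gset G) : gset G := Gset (prod_gset_on X Y).

Definition conj_gset : gset G := @Gset G (fun x => isotropy x : finType)
  (@GsetOn G (fun x => isotropy x : finType) (@conj_hom G)
     (@conj_hom1 G) (@conj_hom_comp G)).

End GsetOps.

Section Omega.

Variables (G : groupoid) (t : trivialization G).
Implicit Types x y z : G.

(* The pair (H, C) with C a left coset kH is the element <H, kH>. *)
Definition Omega_obj x : finType :=
  {p : {group isotropy x} * {set isotropy x} |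
    p.2 \in lcosets p.1 [set: isotropy x]}.

Definition lam x y (g : hom x y) : hom x y := lambda t (connected_hom g).

Definition Omega_pair x y (g : hom x y)
    (p : {group isotropy x} * {set isotropy x}) :
    {group isotropy y} * {set isotropy y} :=
  ((conj_morphism (lam g) @* p.1)%G,
   [set (g ** c ** (lam g)^-1 : isotropy y) | c : isotropy x in p.2]).

Lemma Omega_pairP x y (g : hom x y) (u : Omega_obj x) :
  (Omega_pair g (val u)).2 \in
    lcosets (Omega_pair g (val u)).1 [set: isotropy y].
Proof.
case: u => -[H C] /= /lcosetsP[k _ ->].
apply/lcosetsP; exists (g ** k ** (lam g)^-1 : isotropy y); rewrite ?inE //.
rewrite morphimEsub ?subsetT //; apply/setP=> d; apply/imsetP/lcosetP.
  case=> c /lcosetP[h Hh ->] ->; exists (conj_hom (lam g) h).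
    by apply/imsetP; exists h.
  rewrite -[(k * h)%g]/(k ** h) -[RHS]/(_ ** _) /conj_hom.
  by rewrite !gcompA gcompKV.
case=> e /imsetP[h Hh ->] ->; exists (k * h)%g; first by apply/lcosetP; exists h.
by rewrite -[(k * h)%g]/(k ** h) -[LHS]/(_ ** _) /conj_hom !gcompA gcompKV.
Qed.

Definition Omega_act x y (g : hom x y) (u : Omega_obj x) : Omega_obj y :=
  exist _ (Omega_pair g (val u)) (Omega_pairP g u).

Lemma Omega_act1 x u : Omega_act (gid x) u = u.
Proof.
have l1 : lam (gid x) = gid x by apply: lambda1.
apply: val_inj; case: u => -[H C] /= _; congr pair.
  apply: val_inj => /=; rewrite morphimEsub ?subsetT // l1.
  by rewrite (eq_imset _ (@conj_hom1 G x)) imset_id.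
rewrite l1 ginv1 -[RHS]imset_id; apply: eq_imset => c.
by rewrite gcompg1 gcomp1g.
Qed.

Lemma Omega_actM x y z (g : hom y z) (f : hom x y) u :
  Omega_act (g ** f) u = Omega_act g (Omega_act f u).
Proof.
have lM : lam (g ** f) = lam g ** lam f by rewrite /lam (lambdaM t _ _ (connected_hom (g ** f))).
apply: val_inj; case: u => -[H C] /= _; congr pair.
  apply: val_inj => /=; rewrite !morphimEsub ?subsetT // lM -imset_comp.
  by apply: eq_imset => h; apply: conj_hom_comp.
rewrite lM -imset_comp; apply: eq_imset => c /=.
by rewrite ginvM !gcompA.
Qed.

Definition Omega : gset G := Gset (GsetOn Omega_act1 Omega_actM).

End Omega.

Section Representations.

Variables (k : comPzRingType) (G : groupoid).

Definition finitely_generated (V : lmodType k) : Prop :=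
  exists (n : nat) (e : 'I_n -> V),
    forall v, exists c : 'I_n -> k, v = \sum_i c i *: e i.

Record rep := Rep {
  rep_obj :> G -> lmodType k;
  rep_fg : forall x, finitely_generated (rep_obj x);
  rep_map : forall x y, hom x y -> {linear rep_obj x -> rep_obj y};
  rep_map1 : forall x v, rep_map (gid x) v = v;
  rep_mapM : forall x y z (g : hom y z) (f : hom x y) v,
    rep_map (g ** f) v = rep_map g (rep_map f v);
}.

Record rep_hom (M N : rep) := RepHom {
  rep_fun :> forall x, {linear M x -> N x};
  rep_nat : forall x y (g : hom x y) v,
    rep_fun y (rep_map M g v) = rep_map N g (rep_fun x v);
}.

Lemma linear_ext (U V : lmodType k) (f g : {linear U -> V}) : f =1 g -> f = g.
Proof.
case: f g => f [[[f0 fD]] [fZ]] [g [[[g0 gD]] [gZ]]] /= /funext fg.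
case: _ / fg g0 gD gZ => g0 gD gZ; rewrite (Prop_irrelevance f0 g0).
by rewrite (Prop_irrelevance fD gD) (Prop_irrelevance fZ gZ).
Qed.

Lemma rep_hom_ext M N (f g : rep_hom M N) : (forall x, f x =1 g x) -> f = g.
Proof.
case: f g => f fN [g gN] /= fg.
have e : f = g by apply: functional_extensionality_dep => x; apply/linear_ext/fg.
case: _ / e gN {fg} => gN; by rewrite (Prop_irrelevance fN gN).
Qed.

HB.instance Definition _ M N := gen_eqMixin (rep_hom M N).
HB.instance Definition _ M N := gen_choiceMixin (rep_hom M N).

Section HomGroup.

Variables M N : rep.

Definition rep_hom_zero : rep_hom M N.
Proof.
refine (@RepHom M N (fun x => \0 : {linear M x -> N x}) _).
by move=> x y g v /=; rewrite raddf0.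
Defined.

Definition rep_hom_opp (f : rep_hom M N) : rep_hom M N.
Proof.
refine (@RepHom M N (fun x => \- (f x) : {linear M x -> N x}) _).
by move=> x y g v /=; rewrite rep_nat raddfN.
Defined.

Definition rep_hom_add (f g : rep_hom M N) : rep_hom M N.
Proof.
refine (@RepHom M N (fun x => f x \+ g x : {linear M x -> N x}) _).
by move=> x y h v /=; rewrite !rep_nat raddfD.
Defined.

Lemma rep_hom_addA : associative rep_hom_add.
Proof. by move=> f g h; apply: rep_hom_ext => x v /=; rewrite addrA. Qed.

Lemma rep_hom_addC : commutative rep_hom_add.
Proof. by move=> f g; apply: rep_hom_ext => x v /=; rewrite addrC. Qed.

Lemma rep_hom_add0 : left_id rep_hom_zero rep_hom_add.
Proof. by move=> f; apply: rep_hom_ext => x v /=; rewrite add0r. Qed.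

Lemma rep_hom_addN : left_inverse rep_hom_zero rep_hom_opp rep_hom_add.
Proof. by move=> f; apply: rep_hom_ext => x v /=; rewrite addNr. Qed.

HB.instance Definition _ := GRing.isZmodule.Build (rep_hom M N)
  rep_hom_addA rep_hom_addC rep_hom_add0 rep_hom_addN.

End HomGroup.

Definition rep_hom_id (M : rep) : rep_hom M M.
Proof. by refine (@RepHom M M (fun x => idfun : {linear M x -> M x}) _). Defined.

Definition rep_hom_comp (M N P : rep) (g : rep_hom N P) (f : rep_hom M N) :
  rep_hom M P.
Proof.
refine (@RepHom M P (fun x => g x \o f x : {linear M x -> P x}) _).
by move=> x y h v /=; rewrite !rep_nat.
Defined.

Section EndRing.

Variable M : rep.

Definition rep_end : Type := rep_hom M M.
HB.instance Definition _ := GRing.Zmodule.on rep_end.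

Lemma rep_end_mulA : associative (@rep_hom_comp M M M).
Proof. by move=> f g h; apply: rep_hom_ext. Qed.

Lemma rep_end_mul1l : left_id (rep_hom_id M) (@rep_hom_comp M M M).
Proof. by move=> f; apply: rep_hom_ext. Qed.

Lemma rep_end_mul1r : right_id (rep_hom_id M) (@rep_hom_comp M M M).
Proof. by move=> f; apply: rep_hom_ext. Qed.

Lemma rep_end_mulDl : left_distributive (@rep_hom_comp M M M) +%R.
Proof. by move=> f g h; apply: rep_hom_ext. Qed.

Lemma rep_end_mulDr : right_distributive (@rep_hom_comp M M M) +%R.
Proof. by move=> f g h; apply: rep_hom_ext => x v /=; rewrite raddfD. Qed.

HB.instance Definition _ := GRing.Zmodule_isPzRing.Build rep_end
  rep_end_mulA rep_end_mul1l rep_end_mul1r rep_end_mulDl rep_end_mulDr.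

End EndRing.

Section FreeModule.

Variable X : finType.

Definition free_mod : lmodType k := {ffun X -> k^o}.

Definition free_basis (u : X) : free_mod := [ffun v => (v == u)%:R].

Lemma free_modE (f : {ffun X -> k^o}) : f = \sum_u f u *: free_basis u.
Proof.
apply/ffunP=> v; rewrite sum_ffunE (bigD1 v) //= !ffunE eqxx big1 ?addr0.
  exact/esym/mulr1.
by move=> u /negPf uv; rewrite !ffunE eq_sym uv; apply: mulr0.
Qed.

Lemma free_mod_fg : finitely_generated free_mod.
Proof.
exists #|X|, (fun i => free_basis (enum_val i)) => f.
exists (fun i => (f : {ffun X -> k^o}) (enum_val i)).
rewrite [LHS]free_modE (reindex (@enum_val X predT)) //=.
by apply: onW_bij; apply: enum_val_bij.
Qed.

End FreeModule.

Section LinearExtension.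

Variables (X Y : finType) (h : X -> Y).

Definition linear_extension_fun (f : free_mod X) : free_mod Y :=
  \sum_u (f : {ffun X -> k^o}) u *: free_basis (h u).

Lemma linear_extension_linear : linear linear_extension_fun.
Proof.
move=> a f g; rewrite /linear_extension_fun scaler_sumr -big_split /=.
by apply: eq_bigr => u _; rewrite !ffunE scalerDl scalerA.
Qed.

HB.instance Definition _ := GRing.isLinear.Build k (free_mod X) (free_mod Y)
  _ linear_extension_fun linear_extension_linear.

Definition linear_extension : {linear free_mod X -> free_mod Y} :=
  linear_extension_fun.

Lemma linear_extensionE u :
  linear_extension (free_basis u) = free_basis (h u).
Proof.
rewrite /= /linear_extension_fun (bigD1 u) //= ffunE eqxx scale1r big1 ?addr0 //.
by move=> v /negPf vu; rewrite ffunE vu scale0r.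
Qed.

End LinearExtension.

Lemma free_mod_ext (X : finType) (V : lmodType k) (f g : {linear free_mod X -> V}) :
  (forall u, f (free_basis u) = g (free_basis u)) -> f =1 g.
Proof.
move=> fg v; rewrite [v]free_modE !linear_sum; apply: eq_bigr => u _.
by rewrite !linearZ_LR /= fg.
Qed.

Definition perm_rep (X : gset G) : rep.
Proof.
refine (@Rep (fun x => free_mod (X x)) (fun x => free_mod_fg (X x))
  (fun x y (g : hom x y) => linear_extension (act X g)) _ _).
- move=> x; apply: (free_mod_ext (g := idfun)) => u.
  by rewrite linear_extensionE act1.
- move=> x y z g f.
  apply: (free_mod_ext
    (g := linear_extension (act X g) \o linear_extension (act X f))) => u.
  by rewrite /= !linear_extensionE actM.
Defined.

End Representations.

Definition yoshida_algebra (k : comPzRingType) (G : groupoid)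
    (t : trivialization G) : pzRingType :=
  rep_end (perm_rep k (prod_gset (Omega t) (Omega t))).

(* Isomorphism classes can only be collected into a [choiceType] if the finite
   sets range over a small type; [Set] contains a copy of every finite set, so
   no isomorphism class is lost. *)
Record small_finset := SmallFinset {
  small_sort : Set;
  small_class : Finite.axioms_ small_sort;
}.

Coercion small_finType (X : small_finset) : finType :=
  Finite.Pack (small_class X).

Definition small_prod (X Y : small_finset) : small_finset :=
  @SmallFinset (small_sort X * small_sort Y)%type
    (Finite.class (X * Y : finType)%type).
Definition small_sum (X Y : small_finset) : small_finset :=
  @SmallFinset (small_sort X + small_sort Y)%type
    (Finite.class (X + Y : finType)%type).
Definition small_void : small_finset := @SmallFinset void (Finite.class (void : finType)).
Definition small_unit : small_finset := @SmallFinset unit (Finite.class (unit : finType)).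

Record small_gset (G : groupoid) := SmallGset {
  small_obj : G -> small_finset;
  small_struct : gset_on (fun x => small_obj x);
}.

Coercion gset_of_small (G : groupoid) (X : small_gset G) : gset G :=
  Gset (small_struct X).

Section Crossed.

Variable G : groupoid.

Record crossed := Crossed {
  crossed_gset :> small_gset G;
  crossed_map : gset_hom crossed_gset (conj_gset G);
}.

Record crossed_hom (X Y : crossed) := CrossedHom {
  crossed_hom_map :> gset_hom X Y;
  crossed_hom_over : forall x (u : gset_of_small X x),
    crossed_map Y x (crossed_hom_map x u) = crossed_map X x u;
}.

Definition crossed_iso (X Y : crossed) : Prop :=
  exists (f : crossed_hom X Y) (g : crossed_hom Y X),
    forall x, cancel (f x) (g x) /\ cancel (g x) (f x).

Lemma crossed_isoI (X Y : crossed)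
    (f : forall x, gset_of_small X x -> gset_of_small Y x)
    (g : forall x, gset_of_small Y x -> gset_of_small X x) :
  (forall x y (a : hom x y) u,
    f y (act (gset_of_small X) a u) = act (gset_of_small Y) a (f x u)) ->
  (forall x u, crossed_map Y x (f x u) = crossed_map X x u) ->
  (forall x, cancel (f x) (g x)) -> (forall x, cancel (g x) (f x)) ->
  crossed_iso X Y.
Proof.
move=> fN fo fK gK.
have gN x y (a : hom x y) v :
    g y (act (gset_of_small Y) a v) = act (gset_of_small X) a (g x v).
  by rewrite -{1}(gK x v) -fN fK.
have go x v : crossed_map X x (g x v) = crossed_map Y x v by rewrite -fo gK.
by exists (@CrossedHom X Y (GsetHom fN) fo), (@CrossedHom Y X (GsetHom gN) go).
Qed.

Lemma crossed_iso_refl X : crossed_iso X X.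
Proof. by apply: (@crossed_isoI X X (fun _ u => u) (fun _ u => u)). Qed.

Lemma crossed_iso_sym X Y : crossed_iso X Y -> crossed_iso Y X.
Proof. by case=> f [g h]; exists g, f => x; case: (h x). Qed.

Lemma crossed_iso_trans X Y Z :
  crossed_iso X Y -> crossed_iso Y Z -> crossed_iso X Z.
Proof.
case=> f [f' h] [g [g' k]].
apply: (@crossed_isoI X Z (fun x u => g x (f x u)) (fun x u => f' x (g' x u))).
- by move=> x y a u; rewrite !gset_nat.
- by move=> x u; rewrite !crossed_hom_over.
- by move=> x u; rewrite (k x).1 (h x).1.
- by move=> x u; rewrite (h x).2 (k x).2.
Qed.

Lemma conj_homMg (x y : G) (g : hom x y) (a b : isotropy x) :
  conj_hom g (a * b)%g = (conj_hom g a * conj_hom g b)%g.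
Proof. by rewrite conj_homM ?inE. Qed.

Definition small_gset_sum (X Y : small_gset G) : small_gset G :=
  @SmallGset G (fun x => small_sum (small_obj X x) (small_obj Y x))
    (sum_gset_on (small_struct X) (small_struct Y)).

Definition small_gset_prod (X Y : small_gset G) : small_gset G :=
  @SmallGset G (fun x => small_prod (small_obj X x) (small_obj Y x))
    (prod_gset_on (small_struct X) (small_struct Y)).

Definition small_gset_empty : small_gset G :=
  @SmallGset G (fun _ => small_void) (empty_gset_on G).

Definition small_gset_unit : small_gset G :=
  @SmallGset G (fun _ => small_unit) (unit_gset_on G).

Definition crossed_sum (X Y : crossed) : crossed.
Proof.
refine (@Crossed (small_gset_sum X Y)
  (@GsetHom G (small_gset_sum X Y) (conj_gset G)
    (fun x (w : gset_of_small X x + gset_of_small Y x) => match w with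
       | inl u => crossed_map X x u | inr v => crossed_map Y x v end) _)).
by move=> x y g [u|v];
  [apply: (gset_nat (crossed_map X))|apply: (gset_nat (crossed_map Y))].
Defined.

Definition crossed_prod (X Y : crossed) : crossed.
Proof.
refine (@Crossed (small_gset_prod X Y)
  (@GsetHom G (small_gset_prod X Y) (conj_gset G)
    (fun x (w : gset_of_small X x * gset_of_small Y x) =>
       ((crossed_map X x w.1 : isotropy x) * crossed_map Y x w.2)%g) _)).
move=> x y g [u v]; rewrite [RHS]conj_homMg.
by congr (_ * _)%g;
  [apply: (gset_nat (crossed_map X))|apply: (gset_nat (crossed_map Y))].
Defined.

Definition crossed_zero : crossed.
Proof.
by refine (@Crossed small_gset_empty
  (@GsetHom G small_gset_empty (conj_gset G)
    (fun x (u : void) => match u with end) _)).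
Defined.

Definition crossed_one : crossed.
Proof.
refine (@Crossed small_gset_unit
  (@GsetHom G small_gset_unit (conj_gset G) (fun x _ => 1%g : isotropy x) _)).
by move=> x y g u; apply/esym/(morph1 (conj_morphism g)).
Defined.

HB.instance Definition _ := gen_eqMixin crossed.
HB.instance Definition _ := gen_choiceMixin crossed.

Definition crossed_class :=
  {eq_quot prop_equiv crossed_iso_refl crossed_iso_sym crossed_iso_trans}.
HB.instance Definition _ := Choice.on crossed_class.

Definition class_of (X : crossed) : crossed_class := \pi X.

Lemma class_ofP X Y : class_of X = class_of Y <-> crossed_iso X Y.
Proof. exact: prop_quotP. Qed.

Lemma class_repr X : crossed_iso (qrepr (class_of X)) X.
Proof. exact: prop_quot_repr. Qed.

Lemma classW (P : crossed_class -> Prop) :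
  (forall X, P (class_of X)) -> forall c, P c.
Proof. by move=> h; elim/quotW. Qed.

Definition class_add (c d : crossed_class) : crossed_class :=
  class_of (crossed_sum (qrepr c) (qrepr d)).
Definition class_mul (c d : crossed_class) : crossed_class :=
  class_of (crossed_prod (qrepr c) (qrepr d)).

Lemma class_addE X Y :
  class_add (class_of X) (class_of Y) = class_of (crossed_sum X Y).
Proof.
apply/class_ofP; have [f [f' h]] := class_repr X; have [g [g' k]] := class_repr Y.
apply: (@crossed_isoI (crossed_sum _ _) (crossed_sum X Y)
  (fun x w => match w with inl u => inl (f x u) | inr v => inr (g x v) end)
  (fun x w => match w with inl u => inl (f' x u) | inr v => inr (g' x v) end)).
- by move=> x y a [u|v];
  [congr inl; apply: (gset_nat f)|congr inr; apply: (gset_nat g)].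
- by move=> x [u|v]; [apply: (crossed_hom_over f)|apply: (crossed_hom_over g)].
- by move=> x [u|v]; [congr inl; apply: (h x).1|congr inr; apply: (k x).1].
- by move=> x [u|v]; [congr inl; apply: (h x).2|congr inr; apply: (k x).2].
Qed.

Lemma class_mulE X Y :
  class_mul (class_of X) (class_of Y) = class_of (crossed_prod X Y).
Proof.
apply/class_ofP; have [f [f' h]] := class_repr X; have [g [g' k]] := class_repr Y.
apply: (@crossed_isoI (crossed_prod _ _) (crossed_prod X Y)
  (fun x w => (f x w.1, g x w.2)) (fun x w => (f' x w.1, g' x w.2))).
- by move=> x y a [u v]; congr pair; [apply: (gset_nat f)|apply: (gset_nat g)].
- by move=> x [u v]; congr (_ * _)%g;
  [apply: (crossed_hom_over f)|apply: (crossed_hom_over g)].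
- by move=> x [u v]; congr pair; [apply: (h x).1|apply: (k x).1].
- by move=> x [u v]; congr pair; [apply: (h x).2|apply: (k x).2].
Qed.

Lemma class_addA : associative class_add.
Proof.
elim/classW=> X; elim/classW=> Y; elim/classW=> Z; rewrite !class_addE.
apply/class_ofP.
apply: (@crossed_isoI (crossed_sum X (crossed_sum Y Z))
    (crossed_sum (crossed_sum X Y) Z)
  (fun x w => match w with inl u => inl (inl u)
     | inr (inl v) => inl (inr v) | inr (inr r) => inr r end)
  (fun x w => match w with inl (inl u) => inl u
     | inl (inr v) => inr (inl v) | inr r => inr (inr r) end)).
- by move=> x y a [u|[v|w]].
- by move=> x [u|[v|w]].
- by move=> x [u|[v|w]].
- by move=> x [[u|v]|w].
Qed.

Lemma class_addC : commutative class_add.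
Proof.
elim/classW=> X; elim/classW=> Y; rewrite !class_addE; apply/class_ofP.
apply: (@crossed_isoI (crossed_sum X Y) (crossed_sum Y X)
  (fun x w => match w with inl u => inr u | inr v => inl v end)
  (fun x w => match w with inl u => inr u | inr v => inl v end)).
- by move=> x y a [u|v].
- by move=> x [u|v].
- by move=> x [u|v].
- by move=> x [u|v].
Qed.

Lemma class_add0 : left_id (class_of crossed_zero) class_add.
Proof.
elim/classW=> X; rewrite class_addE; apply/class_ofP.
apply: (@crossed_isoI (crossed_sum crossed_zero X) X
  (fun x (w : void + _) => match w with
     | inl u => match u with end | inr v => v end)
  (fun x w => inr w)) => //.
- by move=> x y a [[]|v].
- by move=> x [[]|v].
- by move=> x [[]|v].
Qed.

Lemma class_mulA : associative class_mul.
Proof.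
elim/classW=> X; elim/classW=> Y; elim/classW=> Z; rewrite !class_mulE.
apply/class_ofP.
apply: (@crossed_isoI (crossed_prod X (crossed_prod Y Z))
    (crossed_prod (crossed_prod X Y) Z)
  (fun x w => ((w.1, w.2.1), w.2.2)) (fun x w => (w.1.1, (w.1.2, w.2)))) => //.
- by move=> x [u [v w]] /=; rewrite mulgA.
- by move=> x [u [v w]].
- by move=> x [[u v] w].
Qed.

Lemma class_mul1l : left_id (class_of crossed_one) class_mul.
Proof.
elim/classW=> X; rewrite class_mulE; apply/class_ofP.
apply: (@crossed_isoI (crossed_prod crossed_one X) X
  (fun x w => w.2) (fun x u => (tt, u))) => //.
- by move=> x [u v] /=; rewrite mul1g.
- by move=> x [[] v].
Qed.

Lemma class_mul1r : right_id (class_of crossed_one) class_mul.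
Proof.
elim/classW=> X; rewrite class_mulE; apply/class_ofP.
apply: (@crossed_isoI (crossed_prod X crossed_one) X
  (fun x w => w.1) (fun x u => (u, tt))) => //.
- by move=> x [u v] /=; rewrite mulg1.
- by move=> x [u []].
Qed.

Lemma class_mulDl : left_distributive class_mul class_add.
Proof.
elim/classW=> X; elim/classW=> Y; elim/classW=> Z.
rewrite !(class_addE, class_mulE); apply/class_ofP.
apply: (@crossed_isoI (crossed_prod (crossed_sum X Y) Z)
    (crossed_sum (crossed_prod X Z) (crossed_prod Y Z))
  (fun x w => match w.1 with inl u => inl (u, w.2) | inr v => inr (v, w.2) end)
  (fun x w => match w with inl u => (inl u.1, u.2) | inr v => (inr v.1, v.2) end)).
- by move=> x y a [[u|v] w].
- by move=> x [[u|v] w].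
- by move=> x [[u|v] w].
- by move=> x [[u w]|[v w]].
Qed.

Lemma class_mulDr : right_distributive class_mul class_add.
Proof.
elim/classW=> X; elim/classW=> Y; elim/classW=> Z.
rewrite !(class_addE, class_mulE); apply/class_ofP.
apply: (@crossed_isoI (crossed_prod X (crossed_sum Y Z))
    (crossed_sum (crossed_prod X Y) (crossed_prod X Z))
  (fun x w => match w.2 with inl u => inl (w.1, u) | inr v => inr (w.1, v) end)
  (fun x w => match w with inl u => (u.1, inl u.2) | inr v => (v.1, inr v.2) end)).
- by move=> x y a [w [u|v]].
- by move=> x [w [u|v]].
- by move=> x [w [u|v]].
- by move=> x [[w u]|[w v]].
Qed.

Lemma class_mul0l : left_zero (class_of crossed_zero) class_mul.
Proof.
elim/classW=> X; rewrite class_mulE; apply/class_ofP.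
apply: (@crossed_isoI (crossed_prod crossed_zero X) crossed_zero
  (fun x w => w.1) (fun x (u : void) => match u with end)).
- by move=> x y a [].
- by move=> x [[]].
- by move=> x [[]].
- by move=> x [].
Qed.

Lemma class_mul0r : right_zero (class_of crossed_zero) class_mul.
Proof.
elim/classW=> X; rewrite class_mulE; apply/class_ofP.
apply: (@crossed_isoI (crossed_prod X crossed_zero) crossed_zero
  (fun x w => w.2) (fun x (u : void) => match u with end)).
- by move=> x y a [].
- by move=> x [? []].
- by move=> x [? []].
- by move=> x [].
Qed.

HB.instance Definition _ := GRing.isPzSemiRing.Build crossed_class
  class_addA class_addC class_add0 class_mulA class_mul1l class_mul1r
  class_mulDl class_mulDr class_mul0l class_mul0r.

Definition crossed_burnside : pzRingType := groth crossed_class.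

End Crossed.

Definition crossed_burnside_over (k : comPzRingType) (G : groupoid) : pzRingType :=
  tensor k (crossed_burnside G).

(* Main.v *)
(**
  A crossed G-set theta : Y -> G^c acts on every representation M by
  v |-> sum_(u in Y(x)) M(theta u) v for v in M(x).  By naturality of theta this
  is an endomorphism of M commuting with all others, and disjoint unions and
  tensor products go to sums and composites; extending to the Grothendieck ring
  and to k gives a ring morphism from the crossed Burnside ring to Z(End M).

  It is onto when M = k[X] and every X(x) contains a point e_x with trivial
  stabilizer, as Omega^2 does.  Indeed e_x can be sent to any w in X(x) by an
  endomorphism of k[X]; since a central z commutes with it, z acts on k[X(x)] as
  sum_a c_x(a) a, where c_x(a) is the coefficient of a e_x in z(e_x).  Naturality
  of z and freeness of e_x make c invariant under conjugation.
*)
From HB Require Import structures.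
From mathcomp Require Import all_boot all_order all_algebra all_fingroup.
Require Import Defs.

Set Implicit Arguments.
Unset Strict Implicit.
Unset Printing Implicit Defensive.

Import GRing.Theory.
Local Open Scope ring_scope.
Local Open Scope groupoid_scope.

(** * Universal property of the Grothendieck ring *)

Section GrothendieckLift.

Variables (R : pzSemiRingType) (S : pzRingType) (f : {rmorphism R -> S}).

Definition groth_lift (x : groth R) : S := f (qrepr x).1 - f (qrepr x).2.

(** The chosen representative agrees with [p] up to a common summand, whose image cancels in the
    additive group of [S]. *)
Lemma groth_liftE p : groth_lift (groth_pi p) = f p.1 - f p.2.
Proof.
rewrite /groth_lift; have [c /(congr1 f)] := groth_repr p.
rewrite !raddfD => /addIr e; apply/eqP.
by rewrite subr_eq addrAC eq_sym subr_eq eq_sym e.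
Qed.

Lemma groth_lift_is_zmod_morphism : zmod_morphism groth_lift.
Proof.
elim/grothW=> p; elim/grothW=> q.
rewrite [- groth_pi q]groth_oppE [X in groth_lift X]groth_addE !groth_liftE /=.
by rewrite !(rmorphD f) !opprD opprK addrACA [- f q.1 + _]addrC.
Qed.

Lemma groth_lift_is_monoid_morphism : monoid_morphism groth_lift.
Proof.
split; first by rewrite [LHS]groth_liftE /= rmorph1 raddf0 subr0.
elim/grothW=> p; elim/grothW=> q; rewrite [X in groth_lift X]groth_mulE !groth_liftE /=.
by rewrite !(rmorphD f) !(rmorphM f) mulrBl !mulrBr opprD opprB addrACA.
Qed.

HB.instance Definition _ :=
  GRing.isZmodMorphism.Build (groth R) S groth_lift groth_lift_is_zmod_morphism.
HB.instance Definition _ :=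
  GRing.isMonoidMorphism.Build (groth R) S groth_lift groth_lift_is_monoid_morphism.

End GrothendieckLift.

(** * Universal property of the tensor product of rings *)

Section TensorLift.

Variables (A B S : pzRingType).
Variables (f : {rmorphism A -> S}) (g : {rmorphism B -> S}).
Hypothesis fgC : forall a b, f a * g b = g b * f a.

Definition tensor_seq_lift (s : seq (A * B)) : S :=
  \sum_(p <- s) f p.1 * g p.2.

Lemma tensor_seq_lift_eq s s' :
  tensor_eq s s' -> tensor_seq_lift s = tensor_seq_lift s'.
Proof.
rewrite /tensor_seq_lift.
elim=> {s s'} [//|s s' _ //|s s' r _ -> _ //|s s' r r' _ e _ e'|s s'|a a' b|a b b'|b|a];
  rewrite ?big_cat ?big_cons ?big_nil /= ?addr0.
- by rewrite e e'.
- by rewrite addrC.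
- by rewrite raddfD mulrDl.
- by rewrite raddfD mulrDr.
- by rewrite raddf0 mul0r.
- by rewrite raddf0 mulr0.
Qed.

(** The commutation proof is an argument so that the ring morphism instance, whose multiplicativity
    depends on it, can recover it from the term. *)
Definition tensor_lift of (forall a b, f a * g b = g b * f a) :=
  fun x : tensor A B => tensor_seq_lift (qrepr x).
Local Notation lift := (tensor_lift fgC).

Lemma tensor_liftE s : lift (tensor_pi s) = \sum_(p <- s) f p.1 * g p.2.
Proof. exact/tensor_seq_lift_eq/tensor_repr. Qed.

Lemma tensor_lift_is_nmod_morphism : nmod_morphism lift.
Proof.
split; first by rewrite [LHS]tensor_liftE big_nil.
elim/tensorW=> s; elim/tensorW=> r.
by rewrite [X in lift X]tensor_addE !tensor_liftE big_cat.
Qed.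

Lemma tensor_lift_is_monoid_morphism : monoid_morphism lift.
Proof.
split; first by rewrite [LHS]tensor_liftE big_seq1 !rmorph1 mulr1.
elim/tensorW=> s; elim/tensorW=> r.
rewrite [X in lift X]tensor_mulE !tensor_liftE big_allpairs_dep big_distrl /=.
apply: eq_bigr => p _; rewrite big_distrr /=; apply: eq_bigr => q _.
(* The two sides differ by the order of the inner factors [f q.1] and [g p.2]. *)
by rewrite !rmorphM !mulrA; congr (_ * _); rewrite -!mulrA fgC.
Qed.

HB.instance Definition _ :=
  GRing.isNmodMorphism.Build (tensor A B) S lift tensor_lift_is_nmod_morphism.
HB.instance Definition _ :=
  GRing.isMonoidMorphism.Build (tensor A B) S lift tensor_lift_is_monoid_morphism.

End TensorLift.

(** * Action of a morphism on a G-set and on its free module *)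

Lemma act_bij (G : groupoid) (X : gset G) (x y : G) (g : hom x y) : bijective (act X g).
Proof.
by exists (act X g^-1) => u; rewrite -actM ?gcompVg ?gcompgV act1.
Qed.

Lemma act_inj (G : groupoid) (X : gset G) (y z : G) (g : hom y z) : injective (act X g).
Proof. exact/bij_inj/act_bij. Qed.

(** By injectivity of the action, [u] is the only point sent to [act X g u]. *)
Lemma linear_extension_actE (k : comPzRingType) (G : groupoid) (X : gset G)
    (y z : G) (g : hom y z) (v : free_mod k (X y)) u :
  (linear_extension k (act X g) v : {ffun X z -> k^o}) (act X g u) =
  (v : {ffun X y -> k^o}) u.
Proof.
rewrite /= /linear_extension_fun sum_ffunE (bigD1 u) //= !ffunE eqxx big1 ?addr0.
  exact: mulr1.
move=> u' /negPf uu'; rewrite !ffunE (inj_eq (@act_inj _ X _ _ g)) eq_sym uu'.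
exact: mulr0.
Qed.

(** * Central endomorphisms from scalars and crossed G-sets *)

Section CrossedAction.

Variables (k : comPzRingType) (G : groupoid) (M : rep k G).
Implicit Types (X Y : crossed G) (a : k).

Definition scale_end a : rep_end M.
Proof.
refine (@RepHom k G M M (fun x => a \*: idfun : {linear M x -> M x}) _).
by move=> x y g v /=; rewrite linearZ_LR.
Defined.

Lemma scale_end_central a : scale_end a \in @central (rep_end M).
Proof.
by apply/centralP=> f; apply: rep_hom_ext => x v /=; rewrite linearZ_LR.
Qed.

Definition scale_center a : center (rep_end M) := Center (scale_end_central a).

Lemma scale_center_is_zmod_morphism : zmod_morphism scale_center.
Proof.
move=> a b; apply: val_inj; rewrite raddfB /=; apply: rep_hom_ext => x v /=.
by rewrite scalerBl.
Qed.

Lemma scale_center_is_monoid_morphism : monoid_morphism scale_center.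
Proof.
split=> [|a b]; apply: val_inj; rewrite ?rmorph1 ?rmorphM /=;
  apply: rep_hom_ext => x v /=; first by rewrite scale1r.
by rewrite scalerA.
Qed.

HB.instance Definition _ := GRing.isZmodMorphism.Build k (center (rep_end M))
  scale_center scale_center_is_zmod_morphism.
HB.instance Definition _ := GRing.isMonoidMorphism.Build k (center (rep_end M))
  scale_center scale_center_is_monoid_morphism.

Definition crossed_end_fun X x (v : M x) : M x :=
  \sum_(u : X x) rep_map M (crossed_map X x u : hom x x) v.

Lemma crossed_end_linear X x : linear (@crossed_end_fun X x).
Proof.
move=> a v w; rewrite /crossed_end_fun scaler_sumr -big_split /=.
by apply: eq_bigr => u _; rewrite linearP.
Qed.

HB.instance Definition _ X x := GRing.isLinear.Build k (M x) (M x) _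
  (@crossed_end_fun X x) (@crossed_end_linear X x).

Definition crossed_end X : rep_end M.
Proof.
refine (@RepHom k G M M (fun x => @crossed_end_fun X x : {linear M x -> M x}) _).
move=> x y g v /=; rewrite /crossed_end_fun linear_sum /=.
(* The points over [y] are the translates g u of those over [x], and theta(g u) g = g theta(u). *)
rewrite (reindex (act (gset_of_small X) g)) /=; last first.
  by apply: onW_bij; apply: (act_bij (gset_of_small X) g).
apply: eq_bigr => u _; rewrite (gset_nat (crossed_map X)) -!rep_mapM.
by congr (rep_map M _ v); rewrite /= /conj_hom gcompKV.
Defined.

(** Each summand is the action of a loop of [G], so naturality of [f] moves [f] past it. *)
Lemma crossed_end_central X : crossed_end X \in @central (rep_end M).
Proof.
apply/centralP=> f; apply: rep_hom_ext => x v /=.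
rewrite /crossed_end_fun linear_sum; apply: eq_bigr => u _.
by rewrite rep_nat.
Qed.

Definition crossed_center X : center (rep_end M) := Center (crossed_end_central X).

Lemma crossed_center_iso X Y :
  crossed_iso X Y -> crossed_center X = crossed_center Y.
Proof.
case=> f [g fg]; apply/val_inj/rep_hom_ext => x v /=; rewrite /crossed_end_fun.
rewrite [RHS](reindex (f x)) /=; last first.
  by apply: onW_bij; exists (g x); case: (fg x).
by apply: eq_bigr => u _; rewrite crossed_hom_over.
Qed.

Definition class_center (c : crossed_class G) : center (rep_end M) :=
  crossed_center (qrepr c).

Lemma class_centerE X : class_center (class_of X) = crossed_center X.
Proof. exact/crossed_center_iso/class_repr. Qed.

Lemma class_center_is_nmod_morphism : nmod_morphism class_center.
Proof.
split.
  rewrite [LHS]class_centerE; apply/val_inj/rep_hom_ext => x v /=.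
  by rewrite /crossed_end_fun big1 // => -[].
elim/classW=> X; elim/classW=> Y; rewrite [X in class_center X]class_addE.
rewrite !class_centerE; apply/val_inj; rewrite raddfD; apply: rep_hom_ext => x v /=.
exact: (@big_sumType _ _ _ (gset_of_small X x) (gset_of_small Y x) predT
  (fun u => rep_map M (crossed_map (crossed_sum X Y) x u : hom x x) v)).
Qed.

Lemma class_center_is_monoid_morphism : monoid_morphism class_center.
Proof.
split.
  rewrite [LHS]class_centerE; apply/val_inj; rewrite rmorph1.
  apply: rep_hom_ext => x v /=.
  by rewrite /crossed_end_fun (big_pred1 tt) ?rep_map1 // => -[].
elim/classW=> X; elim/classW=> Y; rewrite [X in class_center X]class_mulE.
rewrite !class_centerE; apply/val_inj; rewrite rmorphM; apply: rep_hom_ext => x v /=.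
rewrite /crossed_end_fun; under [RHS]eq_bigr => u _ do rewrite linear_sum.
rewrite pair_bigA /=; apply: eq_bigr => u _.
exact: rep_mapM.
Qed.

HB.instance Definition _ := GRing.isNmodMorphism.Build (crossed_class G)
  (center (rep_end M)) class_center class_center_is_nmod_morphism.
HB.instance Definition _ := GRing.isMonoidMorphism.Build (crossed_class G)
  (center (rep_end M)) class_center class_center_is_monoid_morphism.

Definition burnside_center : {rmorphism crossed_burnside G -> center (rep_end M)} :=
  groth_lift class_center.

Lemma scale_burnside_commute a (b : crossed_burnside G) :
  scale_center a * burnside_center b = burnside_center b * scale_center a.
Proof.
by apply: val_inj; rewrite !rmorphM; have /centralP := valP (scale_center a); apply.
Qed.

Definition burnside_over_center :
    {rmorphism crossed_burnside_over k G -> center (rep_end M)} :=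
  tensor_lift scale_burnside_commute.

Lemma burnside_centerE X :
  burnside_center (groth_pi (class_of X, 0)) = crossed_center X.
Proof. by rewrite [LHS]groth_liftE /= raddf0 subr0 [LHS]class_centerE. Qed.

(** Evaluates the morphism on sums of pure tensors, the shape of the preimages used for
    surjectivity. *)
Lemma burnside_over_centerE (I : Type) (s : seq I) (c : I -> k)
    (X : I -> crossed G) x v :
  val (burnside_over_center
      (tensor_pi [seq (c i, groth_pi (class_of (X i), 0)) | i <- s])) x v =
  \sum_(i <- s) c i *: crossed_end_fun (X i) v.
Proof.
rewrite [burnside_over_center _]tensor_liftE big_map.
elim: s => [|i s IHs]; first by rewrite !big_nil.
by rewrite !big_cons -{}IHs [X in _ * X]burnside_centerE rmorphD rmorphM.
Qed.

End CrossedAction.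

(* The finType structures of [isotropy x] and [hom x x] are equal only up to
   eta, so this does not hold by conversion. *)
Lemma sum_isotropy (V : nmodType) (G : groupoid) (x : G) (F : hom x x -> V) :
  \sum_(a : isotropy x) F a = \sum_(a : hom x x) F a.
Proof.
apply: (reindex (fun a : hom x x => a : isotropy x)).
by apply: onW_bij; exists id.
Qed.

(** * Copies of G-sets and crossed G-sets in [Set] *)

Section SmallCopy.

(* ['I_n] does not live in [Set], hence initial segments of [nat]. *)
Definition small_ord (n : nat) : Set := {i : nat | (i < n)%N}.

Definition small_ord_ord n (i : small_ord n) : 'I_n := Ordinal (valP i).
Definition ord_small_ord n (i : 'I_n) : small_ord n :=
  exist _ (val i) (ltn_ord i).

Lemma small_ord_ordK n : cancel (@small_ord_ord n) (@ord_small_ord n).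
Proof. by move=> i; apply: val_inj. Qed.

Lemma ord_small_ordK n : cancel (@ord_small_ord n) (@small_ord_ord n).
Proof. by move=> i; apply: val_inj. Qed.

Definition small_copy (T : finType) : small_finset :=
  @SmallFinset (small_ord #|T|)
    (Finite.class (can_type (@small_ord_ordK #|T|) : finType)).

Definition to_small (T : finType) (u : T) : small_copy T :=
  ord_small_ord (enum_rank u).
Definition of_small (T : finType) (i : small_copy T) : T :=
  enum_val (small_ord_ord i).

Lemma to_smallK T : cancel (@to_small T) (@of_small T).
Proof. by move=> u; rewrite /of_small ord_small_ordK enum_rankK. Qed.

Lemma of_smallK T : cancel (@of_small T) (@to_small T).
Proof. by move=> i; rewrite /to_small enum_valK small_ord_ordK. Qed.

Variables (G : groupoid) (Y : gset G) (theta : gset_hom Y (conj_gset G)).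

Definition small_copy_gset : small_gset G.
Proof.
refine (@SmallGset G (fun x => small_copy (Y x))
  (@GsetOn G (fun x => small_copy (Y x))
    (fun x y g i => to_small (act Y g (of_small i))) _ _)).
- by move=> x i; rewrite act1 of_smallK.
- by move=> x y z g f i; rewrite to_smallK actM.
Defined.

(** A [crossed] must take values in [Set], while subsets of isotropy groups live in the universe of
    [G]. *)
Definition crossed_copy : crossed G.
Proof.
refine (@Crossed G small_copy_gset (@GsetHom G small_copy_gset (conj_gset G)
  (fun x i => theta x (of_small i)) _)).
by move=> x y g i /=; rewrite to_smallK gset_nat.
Defined.

Lemma crossed_copy_endE (k : comPzRingType) (M : rep k G) x (v : M x) :
  crossed_end_fun crossed_copy v =
  \sum_(u : Y x) rep_map M (theta x u : hom x x) v.
Proof.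
rewrite [RHS](reindex (@of_small (Y x))) //.
by apply: onW_bij; exists (@to_small (Y x)); [apply: of_smallK|apply: to_smallK].
Qed.

End SmallCopy.

(** * Level sets of class functions as crossed G-sets *)

Section LevelSet.

Variables (G : groupoid) (T : eqType) (c : forall x : G, isotropy x -> T) (r : T).
Hypothesis c_conj : forall x y (g : hom x y) a, c (conj_hom g a) = c a.

Local Notation level x := {a : isotropy x | c a == r}.

Lemma level_act_subproof x y (g : hom x y) (a : level x) :
  c (conj_hom g (val a)) == r.
Proof. by rewrite c_conj (valP a). Qed.

Definition level_gset : gset G.
Proof.
refine (@Gset G (fun x => level x : finType)
  (@GsetOn G (fun x => level x : finType)
    (fun x y g a => exist _ (conj_hom g (val a)) (level_act_subproof g a)) _ _)).
- by move=> x a; apply: val_inj => /=; rewrite conj_hom1.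
- by move=> x y w g f a; apply: val_inj => /=; rewrite conj_hom_comp.
Defined.

Definition level_incl : gset_hom level_gset (conj_gset G).
Proof.
by refine (@GsetHom G level_gset (conj_gset G) (fun x a => val a) _).
Defined.

Lemma level_crossed_endE (k : comPzRingType) (M : rep k G) x (v : M x) :
  crossed_end_fun (crossed_copy level_incl) v =
  \sum_(a : isotropy x | c a == r) rep_map M (a : hom x x) v.
Proof.
rewrite crossed_copy_endE [RHS](reindex_omap (val : level x -> _) insub) /=.
  by apply: eq_bigl => -[a ca] /=; rewrite insubT ca /= eqxx.
by move=> a ca; rewrite insubT.
Qed.

End LevelSet.

(** * Central endomorphisms of k[X] in the presence of free points *)

Section FreePoint.

Variables (k : comPzRingType) (G : groupoid) (X : gset G).
Local Notation M := (perm_rep k X).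

(** Equivalent to a trivial stabilizer, since g e = h e exactly when h^-1 g fixes e. *)
Definition free_point x (e : X x) : Prop :=
  forall y, injective (fun g : hom x y => act X g e).

Section OrbitEnd.

Variables (x : G) (e w : X x).

(** For free [e] this sends g e to g w and kills the basis points outside the orbit of [e]. Summing
    over morphisms makes it natural without choosing a [g] for each point. *)
Definition orbit_end_fun y (v : free_mod k (X y)) : free_mod k (X y) :=
  \sum_(g : hom x y)
    (v : {ffun X y -> k^o}) (act X g e) *: free_basis k (act X g w).

Lemma orbit_end_linear y : linear (@orbit_end_fun y).
Proof.
move=> a v v'; rewrite /orbit_end_fun scaler_sumr -big_split /=.
by apply: eq_bigr => g _; rewrite !ffunE scalerDl scalerA.
Qed.

HB.instance Definition _ y := GRing.isLinear.Build k (free_mod k (X y))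
  (free_mod k (X y)) _ (@orbit_end_fun y) (@orbit_end_linear y).

Definition orbit_end : rep_end M.
Proof.
refine (@RepHom k G M M (fun y => @orbit_end_fun y : {linear M y -> M y}) _).
move=> y z h v /=; rewrite [RHS]linear_sum /= /orbit_end_fun.
rewrite (reindex (fun g : hom x y => h ** g)) /=; last first.
  exists (fun g => h^-1 ** g) => g _.
    by rewrite gcompA gcompVg gcomp1g.
  by rewrite gcompA gcompgV gcomp1g.
apply: eq_bigr => g _.
rewrite [RHS]linearZ_LR [X in _ = _ *: X]linear_extensionE !actM.
by rewrite linear_extension_actE.
Defined.

Lemma orbit_end_point :
  free_point e -> orbit_end x (free_basis k e) = free_basis k w.
Proof.
move=> fe /=; rewrite /orbit_end_fun (bigD1 (gid x)) //= ffunE act1 eqxx scale1r.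
rewrite act1 big1 ?addr0 // => g /negPf g1; rewrite ffunE.
by rewrite -[X in _ == X](act1 X) (inj_eq (@fe x)) g1 scale0r.
Qed.

End OrbitEnd.

Section CentralElement.

Variables (e : forall x, X x) (z : center (rep_end M)).
Hypothesis e_free : forall x, free_point (e x).

Definition central_coef x (a : isotropy x) : k :=
  (val z x (free_basis k (e x)) : {ffun X x -> k^o}) (act X a (e x)).

(** Evaluate at [e x] the commutation of [z] with [orbit_end (e x) w]: one side is z(w), the other
    reads off the coefficients of z(e x). *)
Lemma central_endE x (w : X x) :
  val z x (free_basis k w) =
  \sum_(a : isotropy x) central_coef a *: free_basis k (act X a w).
Proof.
have /centralP/(_ (orbit_end (e x) w)) zC := valP z.
have := congr1 (fun f : rep_end M => f x (free_basis k (e x))) zC.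
rewrite -[LHS]/(val z x (orbit_end (e x) w x _)) orbit_end_point // => ->.
by rewrite sum_isotropy.
Qed.

(** Compare the coefficients of g a e_x in z(g e_x) = g z(e_x). As g e_x may differ from e_y, the
    left side is expanded by [central_endE] at the point g e_x. *)
Lemma central_coef_conj x y (g : hom x y) (a : isotropy x) :
  central_coef (conj_hom g a) = central_coef a.
Proof.
have := rep_nat (val z) g (free_basis k (e x)).
rewrite [rep_map _ _ _]linear_extensionE central_endE.
move/(congr1 (fun v : {ffun X y -> k^o} => v (act X g (act X a (e x))))).
rewrite linear_extension_actE => coefE; apply: etrans coefE.
rewrite sum_ffunE (bigD1 (conj_hom g a)) //= big1 ?addr0.
  rewrite !ffunE -!actM /conj_hom gcompKV eqxx; exact/esym/mulr1.
(* Freeness turns g a e_x = b g e_x into g a = b g, that is b = g a g^-1. *)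
move=> b /eqP ba; rewrite !ffunE -!actM; case: eqP => [/(@e_free x y) gab|_].
  by case: ba; rewrite /conj_hom gab gcompVK.
exact: mulr0.
Qed.

(* The coefficients of [z] form a class function, so its level sets are G-subsets
   of G^c; [z] is the combination of these level sets weighted by the values. *)
Lemma burnside_over_center_onto :
  exists b : crossed_burnside_over k G, burnside_over_center M b = z.
Proof.
(* Values are collected over all objects, since one tensor must serve every [x]; [undup] makes each
   level set count once. *)
pose vals := undup [seq central_coef (tagged p) | p : {x : G & isotropy x}].
pose Y r := crossed_copy (level_incl r central_coef_conj).
exists (tensor_pi [seq (r, groth_pi (class_of (Y r), 0)) | r <- vals]).
apply/val_inj/rep_hom_ext => x; apply: free_mod_ext => w.
rewrite burnside_over_centerE central_endE.
under eq_bigr => r _ do rewrite level_crossed_endE scaler_sumr.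
(* For a fixed [a], only the level r = [central_coef a] contains it. *)
rewrite (exchange_big_dep predT) //=; apply: eq_bigr => a _.
rewrite big_mkcond (bigD1_seq (central_coef a)) ?undup_uniq //=.
  rewrite eqxx linear_extensionE big1 ?addr0 // => r /negPf.
  by rewrite eq_sym => ->.
rewrite mem_undup; apply/mapP; exists (Tagged (fun x : G => isotropy x) a) => //.
by rewrite mem_enum.
Qed.

End CentralElement.

End FreePoint.

(** * A free point of Omega^2 over each object *)

Section OmegaSquare.

Variables (G : groupoid) (t : trivialization G).

Lemma Omega_trivial_subproof (x : G) :
  [set 1%g : isotropy x] \in lcosets 1%G [set: isotropy x].
Proof. by apply/lcosetsP; exists 1%g; rewrite ?inE // lcoset1. Qed.

Definition Omega_trivial x : Omega t x :=
  exist _ (1%G, [set 1%g]) (Omega_trivial_subproof x).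

(** In the first factor, [g] moves the coset {1} to the singleton of g lambda^-1. As lambda depends
    only on the endpoints, this determines [g]. *)
Lemma Omega_square_free_point x :
  @free_point G (prod_gset (Omega t) (Omega t)) x (Omega_trivial x, Omega_trivial x).
Proof.
move=> y g h /(congr1 fst)/(congr1 val)/(congr1 snd)/=.
have <- : lam t g = lam t h by congr lambda; apply: bool_irrelevance.
rewrite !imset_set1 => /set1_inj /(congr1 (fun f => f ** lam t g)).
by rewrite !gcompKV !gcompg1.
Qed.

End OmegaSquare.

Theorem corollary4p10 (k : comPzRingType) (G : groupoid)
    (t : trivialization G) :
  exists f : {rmorphism crossed_burnside_over k G ->
                center (yoshida_algebra k t)},
    forall z : center (yoshida_algebra k t),
      exists b : crossed_burnside_over k G, f b = z.
Proof.
exists (burnside_over_center (perm_rep k (prod_gset (Omega t) (Omega t)))) => z.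
exact: (burnside_over_center_onto z (@Omega_square_free_point G t)).
Qed.
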